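(* Let $\rho>0$ and for each $n\ge 1$ let $Q^n=\{(\xi_1,\dots,\xi_n)\in\mathbb{R}^n:\ |\xi_l|\le\rho,\ 1\le l\le n\}$ be the cube. Then for every $\tau\in\mathbb{C}$, $$\lim_{n\to\infty}\mathscr{M}_{Q^n}(\tau)=\sum_{0\le l<\infty}\left(\frac{\sqrt{\pi}}{2}\right)^l\frac{1}{\Gamma\left(\frac{l}{2}+1\right)\Gamma(l+1)}\,\tau^l .$$
   Context: A compact convex set $K\subset\mathbb{R}^n$ is called solid if its interior is non-empty, equivalently $\mathrm{Vol}_n(K)>0$. Let $B$ denote the closed unit Euclidean ball of $\mathbb{R}^n$ centered at the origin. By Minkowski, for $t>0$ the function $M_K(t)=\mathrm{Vol}_n(K+tB)$ is a polynomial in $t$ of degree $n$ (the Steiner-Minkowski polynomial of $K$); it is then considered for all complex $t$. Its constant coefficient is $\mathrm{Vol}_n(K)$ and its linear coefficient is the surface area $\mathrm{Vol}_{n-1}(\partial K)$. For solid $K$ the shape factor is $\sigma_K=\mathrm{Vol}_{n-1}(\partial K)/\mathrm{Vol}_n(K)>0$. The renormalized Steiner-Minkowski polynomial $\mathscr{M}_K(\tau)$ is the polynomial in $\tau$ of degree $n$ defined by $M_K(t)=\mathrm{Vol}_n(K)\cdot\mathscr{M}_K(\sigma_K t)$, i.e. $\mathscr{M}_K(\tau)=M_K(\tau/\sigma_K)/\mathrm{Vol}_n(K)$. *)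

(* Defs.v *)
From HB Require Import structures.
From mathcomp Require Import all_boot all_order all_algebra.
From mathcomp Require Import all_classical all_reals all_analysis.
From mathcomp Require Export complex.
Import Order.TTheory GRing.Theory Num.Theory.
Import numFieldNormedType.Exports.

Set Implicit Arguments.
Unset Strict Implicit.
Unset Printing Implicit Defensive.

Local Open Scope classical_set_scope.
Local Open Scope ring_scope.
Local Open Scope complex_scope.

(* Lebesgue measure on R^n, as the n-fold product measure
   lebesgue_measure \x (lebesgue_measure \x ... ), transported to tuples along
   (x, t) |-> x :: t.  In dimension 0 it is the unit mass at the only point. *)
Fixpoint lebesgue_tuple (R : realType) (n : nat) :
    set (n.-tuple (measurableTypeR R)) -> \bar R :=
  match n with
  | 0 => \d_[tuple]
  | n'.+1 => pushforward (lebesgue_measure \x @lebesgue_tuple R n')%E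
      (fun p : measurableTypeR R * n'.-tuple (measurableTypeR R) =>
         [tuple of p.1 :: p.2])
  end.

Section ConvexGeometry.
Variables (R : realType) (n : nat).
Implicit Types (A K : set 'rV[R]_n) (t : R).

(* Row vectors carry no measurable structure, hence the detour by tuples. *)
Definition Vol A : \bar R :=
  lebesgue_tuple [set u : n.-tuple (measurableTypeR R) |
                  A (\row_i (tnth u i : R))].

(* The library norm on 'rV[R]_n is the sup norm, so the Euclidean ball is
   written out. *)
Definition unit_ball : set 'rV[R]_n := [set x | \sum_i x 0 i ^+ 2 <= 1].

(* A + t B *)
Definition tube A t : set 'rV[R]_n :=
  [set a + t *: b | a in A & b in unit_ball].

Definition boundary A : set 'rV[R]_n := closure A `\` interior A.

(* (n-1)-dimensional volume of a subset of R^n, as its Minkowski content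
   lim_(t -> 0+) Vol_n(A + tB) / (2t), where 2t is the length of [-t, t]. *)
Definition hypersurface_area A : \bar R :=
  lim ((Vol (tube A t) * ((2 * t)^-1)%:E)%E @[t --> 0^'+]).

(* The polynomial agreeing with t |-> Vol_n(K + tB) on t > 0.  It is unique
   when it exists; the junk value 0 is taken if there is none. *)
Definition steiner_poly K : {poly R} :=
  xget 0 [set p : {poly R} | forall t, 0 < t -> Vol (tube K t) = p.[t]%:E].

Definition shape_factor K : R :=
  fine (hypersurface_area (boundary K)) / fine (Vol K).

(* tau |-> M_K(tau / sigma_K) / Vol_n(K) *)
Definition renorm_steiner_poly K : {poly R} :=
  (fine (Vol K))^-1 *: (steiner_poly K \Po ((shape_factor K)^-1 *: 'X)).

Definition cube (rho : R) : set 'rV[R]_n :=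
  [set xi | forall l, `|xi 0 l| <= rho].

End ConvexGeometry.

Arguments cube {R} n rho.

Definition ceval (R : realType) (p : {poly R}) (z : R[i]) : R[i] :=
  (map_poly (real_complex R) p).[z].

(* Euler's integral; only meant for x > 0, where it converges. *)
Definition Gamma (R : realType) (x : R) : R :=
  \int[lebesgue_measure]_(t in `]0, +oo[) (t `^ (x - 1) * expR (- t)).

(* Terms of the limit series. *)
Definition cube_limit_term (R : realType) (tau : R[i]) (l : nat) : R[i] :=
  ((Num.sqrt pi / 2) ^+ l / (Gamma (l%:R / 2 + 1) * Gamma (l%:R + 1)))%:C
    * tau ^+ l.

(* Main.v *)
From HB Require Import structures.
Require Import Defs.
From mathcomp Require Import all_boot all_order all_algebra.
From mathcomp Require Import all_classical all_reals all_analysis complex.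
From mathcomp Require Import measurable_realfun ring lra.
Import Order.TTheory GRing.Theory Num.Theory.
Import numFieldNormedType.Exports.
Local Open Scope classical_set_scope.
Local Open Scope ring_scope.
Local Open Scope complex_scope.

(** Write omega_k for the volume of the unit ball of dimension k.  A point x lies
in the t-tube of the cube iff the squares of the excesses max(0, |x_i| - rho)
add up to at most t^2 ([tube_cube]).  The iterated definition of Lebesgue
measure turns this description into a recursion on the dimension: integrating
over one coordinate either multiplies by 2 rho (inside the cube) or convolves
with y |-> y^2 (outside), so the tube has volume
sum_k C(n,k) (2 rho)^(n-k) omega_k t^k ([lebesgue_excess_le]).

The Minkowski content of the boundary of the cube comes from the same recursion:
for t < rho the tube of the boundary is the tube of the cube with an open cube of
side 2(rho - t) removed ([tube_boundary_cube], [lebesgue_excess_shell]), and the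
derivative at 0 gives 2n(2 rho)^(n-1).  Hence the shape factor is n / rho, and the
powers of rho cancel in the renormalized polynomial, which is
sum_k (n(n-1)...(n-k+1) / n^k) (omega_k / (2^k k!)) tau^k
([renorm_steiner_poly_cube]).

The falling factorial ratio differs from 1 by at most k^2 / n, and
omega_k <= 2^k, so the difference with the partial sums of
sum_k omega_k / (2^k k!) tau^k is at most exp(4|tau|) / n ([binomial_series_limit]).

It remains to recognize the coefficients, that is omega_k = sqrt(pi)^k / Gamma(k/2+1)
([ball_vol_Gamma]) and Gamma(l+1) = l! ([Gamma_fact]).  Both follow from one
remark: the Laplace transform of s |-> s_+^(k/2) at 1 is Gamma(k/2+1), and by
Tonelli's theorem the Laplace transform turns convolutions into products
([laplace_convolution]).  Convolving with y |-> y^2 produces the next ball and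
a Gaussian factor sqrt(pi); convolving with the half-line produces the next
power and a factor 1. *)

(** * Convergence in the complex plane *)

Section ComplexLimits.
Variable R : realType.
Local Notation Re := complex.Re.
Local Notation Im := complex.Im.
Implicit Types (u : nat -> R[i]) (v : nat -> R).

Lemma normc_real (x : R) : `|x%:C| = `|x|%:C.
Proof. by rewrite normc_def/= expr0n addr0 sqrtr_sqr. Qed.

Lemma normc_le_ReIm (z : R[i]) : `|z| <= (`|Re z| + `|Im z|)%:C.
Proof.
rewrite normc_def lecR -[leRHS]ger0_norm ?addr_ge0// -sqrtr_sqr ler_sqrt ?sqr_ge0//.
by rewrite sqrrD !real_normK ?num_real// -addrA lerD2l lerDr mulrn_wge0// mulr_ge0.
Qed.

Lemma normc_ge_Im (z : R[i]) : `|Im z|%:C <= `|z|.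
Proof.
by rewrite normc_def lecR -sqrtr_sqr ler_sqrt ?addr_ge0 ?sqr_ge0// lerDr sqr_ge0.
Qed.

Lemma cvg_complex u (a b : R) :
  (fun n => Re (u n)) @ \oo --> a -> (fun n => Im (u n)) @ \oo --> b ->
  (u : nat -> R[i]^o) @ \oo --> (a +i* b : R[i]^o).
Proof.
move=> /cvgrPdist_le ua /cvgrPdist_le ub; apply/cvgrPdist_le => e e0.
have eE : e = (Re e)%:C by rewrite RRe_real// gtr0_real.
have r0 : 0 < Re e / 2 by rewrite divr_gt0// -ltcR -eE.
near=> n; apply: (le_trans (normc_le_ReIm _)).
rewrite eE lecR [leRHS]splitr lerD//.
- have -> : Re (a +i* b - u n) = a - Re (u n) by case: (u n).
  by near: n; exact: ua.
- have -> : Im (a +i* b - u n) = b - Im (u n) by case: (u n).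
  by near: n; exact: ub.
Unshelve. all: by end_near. Qed.

Lemma Re_series u n : Re (series u n) = series (fun k => Re (u k)) n.
Proof. by rewrite /series/=; apply: (big_morph (@Re R)) => // -[? ?] [? ?]. Qed.

Lemma Im_series u n : Im (series u n) = series (fun k => Im (u k)) n.
Proof. by rewrite /series/=; apply: (big_morph (@Im R)) => // -[? ?] [? ?]. Qed.

(** The real and imaginary parts are real series, each dominated by v. *)
Lemma is_cvg_series_complex u v : (forall n, `|u n| <= (v n)%:C) ->
  cvgn (series v) -> cvgn (series (u : nat -> R[i]^o)).
Proof.
move=> uv cv.
have v0 n : 0 <= v n by rewrite -ler0c (le_trans _ (uv n)).
have cvg_dom (w : nat -> R) : (forall n, `|w n| <= v n) -> cvgn (series w).
  move=> wv; apply: normed_cvg.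
  by apply: series_le_cvg cv => // n /=.
have /cvg_ex[a ha] : cvgn (series (fun k => Re (u k))).
  by apply: cvg_dom => n; rewrite -lecR (le_trans (normc_ge_Re _)).
have /cvg_ex[b hb] : cvgn (series (fun k => Im (u k))).
  by apply: cvg_dom => n; rewrite -lecR (le_trans (normc_ge_Im _)).
apply/cvg_ex; exists (a +i* b); apply: cvg_complex.
- by under eq_fun do rewrite Re_series.
- by under eq_fun do rewrite Im_series.
Qed.

Lemma cvg0_complex_harmonic (C : R) u :
  (forall n, (0 < n)%N -> `|u n| <= (C / n%:R)%:C) ->
  (u : nat -> R[i]^o) @ \oo --> (0 : R[i]^o).
Proof.
move=> uC.
have Cn : (fun n : nat => C / n%:R) @ \oo --> (0 : R).
  rewrite -cvg_shiftS /=.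
  by have := cvgM (@cvg_cst _ C _ _ _) (@cvg_harmonic R); rewrite mulr0; exact.
have bound w : (forall n, (0 < n)%N -> `|w n| <= C / n%:R) -> w @ \oo --> (0 : R).
  move=> wC; apply/norm_cvg0P; apply: squeeze_cvgr (cvg_cst 0) Cn.
  near=> n; rewrite normr_ge0 /= wC//.
  by near: n; exact: nbhs_infty_gt.
have -> : (0 : R[i]^o) = 0 +i* 0 by [].
apply: cvg_complex; apply: bound => n n0; rewrite -lecR.
- exact: le_trans (normc_ge_Re _) (uC _ n0).
- exact: le_trans (normc_ge_Im _) (uC _ n0).
Unshelve. all: by end_near. Qed.

End ComplexLimits.

(** * Exponential limit of binomial coefficients *)

Section BinomialLimit.
Variable R : realType.

(** The ratio is the product of the factors 1 - j/n for j < k; each factor adds at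
most j/n to the defect, and the sum of these bounds is at most k^2/n. *)
Lemma falling_factorial_ratio n k : (0 < n)%N ->
  0 <= (1 : R) - (n ^_ k)%:R / n%:R ^+ k <= k%:R ^+ 2 / n%:R.
Proof.
move=> n0; have n0R : 0 < n%:R :> R by rewrite ltr0n.
elim: k => [|k /andP[ih1 ih2]].
  by rewrite ffactn0 !expr0 divr1 subrr lexx divr_ge0 ?exprn_ge0.
set q := (n ^_ k)%:R / n%:R ^+ k in ih1 ih2.
have q0 : 0 <= q by rewrite divr_ge0// exprn_ge0.
have -> : (n ^_ k.+1)%:R / n%:R ^+ k.+1 = q * ((n - k)%:R / n%:R) :> R.
  by rewrite ffactnSr natrM exprSr invfM mulrACA.
have r0 : 0 <= (n - k)%:R / n%:R :> R by rewrite divr_ge0.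
have r1 : (n - k)%:R / n%:R <= 1 :> R by rewrite ler_pdivrMr// mul1r ler_nat leq_subr.
have r2 : 1 - (n - k)%:R / n%:R <= k%:R / n%:R :> R.
  rewrite lerBlDl -mulrDl ler_pdivlMr// mul1r -natrD ler_nat.
  by rewrite addnC -leq_subLR leqnn.
apply/andP; split; first by rewrite subr_ge0 mulr_ile1// -subr_ge0.
have -> : 1 - q * ((n - k)%:R / n%:R) = (1 - q) + q * (1 - (n - k)%:R / n%:R) :> R.
  by rewrite mulrBr mulr1 addrA subrK.
apply: (@le_trans _ _ (k%:R ^+ 2 / n%:R + 1 * (k%:R / n%:R))).
  by apply: lerD => //; apply: ler_pM; rewrite ?subr_ge0 // -subr_ge0.
rewrite mul1r -mulrDl ler_pM2r ?invr_gt0// -natrX -natrD -natrX ler_nat.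
by rewrite -!mulnn addnC -mulSn leq_mul.
Qed.

Lemma series_exp_coeff_le (x : R) n : 0 <= x -> series (exp_coeff x) n <= expR x.
Proof.
move=> x0; apply: nondecreasing_cvgn_le; last exact: is_cvg_series_exp_coeff.
by apply: nondecreasing_series => k _ _; exact: exp_coeff_ge0.
Qed.

(** A limit of sums exchanged with the sum, with an explicit rate: the k-th terms
differ by at most (k^2/n) |tau|^k / k!, and k^2 <= 4^k, so that the sums differ
by at most exp(4|tau|)/n. *)
Lemma binomial_series_limit (b : nat -> R) (tau : R[i]) :
  (forall k, 0 <= b k <= k`!%:R^-1) ->
  let a := (fun k => (b k)%:C * tau ^+ k : R[i]^o) in
  cvgn (series a) /\
  (fun n => \sum_(k < n.+1)
      ((n ^_ k)%:R / n%:R ^+ k * b k)%:C * tau ^+ k : R[i]^o) @ \oo --> limn (series a).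
Proof.
move=> hb a.
have [T T0 TE] : exists2 T : R, 0 <= T & `|tau| = T%:C.
  by rewrite normc_def; eexists; last reflexivity; exact: sqrtr_ge0.
have normX k : `|tau ^+ k| = (T ^+ k)%:C by rewrite normrX TE rmorphXn.
have ca : cvgn (series a).
  apply: (@is_cvg_series_complex _ _ (exp_coeff T)) (is_cvg_series_exp_coeff T).
  move=> k; have /andP[b0 b1] := hb k.
  rewrite /a normrM normX normc_real ger0_norm// -rmorphM/= lecR mulrC /exp_coeff/=.
  by rewrite ler_wpM2l// exprn_ge0.
split=> //.
set S := (fun n : nat => _).
pose D n : R[i] := S n - series a n.+1.
have -> : S = (fun n => (D n : R[i]^o) + series a n.+1).
  by apply/funext => n; rewrite /D subrK.
rewrite -[X in _ --> X]add0r; apply: (@cvgD _ R[i]^o); last first.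
  by rewrite (@cvg_shiftS _ (series a)).
apply: (@cvg0_complex_harmonic _ (expR (4 * T))) => n n0.
have n0R : 0 < n%:R :> R by rewrite ltr0n.
rewrite /D /S /series/= big_mkord -sumrB.
apply: (le_trans (ler_norm_sum _ _ _)).
apply: (@le_trans _ _ (\sum_(k < n.+1) (exp_coeff (4 * T) k / n%:R)%:C)); last first.
  rewrite -rmorph_sum/= lecR -mulr_suml ler_pM2r ?invr_gt0//.
  have := @series_exp_coeff_le (4 * T) n.+1; rewrite /series/= big_mkord; apply.
  by rewrite mulr_ge0.
apply: ler_sum => k _; have /andP[b0 b1] := hb k.
have /andP[q0 q1] := falling_factorial_ratio n k n0.
rewrite /a -mulrBl -rmorphB/= normrM normX normc_real -rmorphM/= lecR.
rewrite -[X in `|_ - X|]mul1r -mulrBl -normrN -mulNr opprB ger0_norm ?mulr_ge0//.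
apply: (@le_trans _ _ (k%:R ^+ 2 / n%:R * k`!%:R^-1 * T ^+ k)).
  by rewrite ler_wpM2r ?exprn_ge0// ler_pM.
rewrite /exp_coeff/= exprMn.
have -> : k%:R ^+ 2 / n%:R / k`!%:R * T ^+ k =
          k%:R ^+ 2 * (T ^+ k / k`!%:R / n%:R) :> R by ring.
have -> : 4 ^+ k * T ^+ k / k`!%:R / n%:R = 4 ^+ k * (T ^+ k / k`!%:R / n%:R) :> R by ring.
rewrite ler_wpM2r ?divr_ge0 ?exprn_ge0//.
rewrite -!natrX ler_nat (_ : 4 = 2 ^ 2)%N// -expnM mulnC expnM leq_exp2r//.
exact/ltnW/ltn_expl.
Qed.

End BinomialLimit.

(** * Half-integer powers and volumes of balls *)

Section RealIntegrals.
Variable R : realType.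
Local Notation mu := (@lebesgue_measure R).
Local Open Scope ereal_scope.

(** The measure a * (image of Lebesgue measure under x |-> a x + b) gives every
interval its length, hence it is Lebesgue measure. *)
Lemma ge0_integral_affine (f : R -> \bar R) (a b : R) : (0 < a)%R ->
  measurable_fun [set: R] f -> (forall x, 0 <= f x) ->
  \int[mu]_x f x = a%:E * \int[mu]_x f (a * x + b)%R.
Proof.
move=> a0 mf f0.
pose phi (x : R) : measurableTypeR R := (a * x + b)%R.
have mphi : measurable_fun [set: R] phi.
  by apply: measurable_funD => //; apply: measurable_funM.
(* The measurability of phi is an argument of the measure structure on the image. *)
have [m mE] : exists m : {measure set (measurableTypeR R) -> \bar R},
    m = pushforward mu phi :> (set (measurableTypeR R) -> \bar R).
  by unshelve eexists (pushforward mu phi); [exact: mphi|].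
have phi_itv c d : phi @^-1` `]c, d]%classic = `]((c - b) / a)%R, ((d - b) / a)%R]%classic.
  apply/seteqP; split => x /=; rewrite !in_itv/= ltr_pdivrMr// ler_pdivlMr//;
    by rewrite ltrBlDr lerBrDr (mulrC x).
pose a' := NngNum (ltW a0).
transitivity (\int[mscale a' m]_x f x).
  apply: eq_measure_integral => A mA _; apply: lebesgue_measure_unique => //.
  move=> _ [[c d]] _ <-.
  rewrite -[RHS]/(a%:E * m `]c, d]%classic) mE /pushforward phi_itv.
  rewrite [in LHS]lebesgue_measure_itv [in RHS]lebesgue_measure_itv/= !lte_fin.
  rewrite ltr_pM2r ?invr_gt0// ltrD2r; case: ifPn => _; last by rewrite mule0.
  rewrite -!EFinB -EFinM; congr EFin.
  by rewrite -mulrBl opprB addrA subrK mulrC divfK// gt_eqF.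
rewrite ge0_integral_mscale//=; congr (_ * _).
by rewrite mE ge0_integral_pushforward// preimage_setT.
Qed.

(** The function s |-> s_+^(k/2).  Its value at 0 for k = 0 is 1: the ball of
dimension 0 and radius 0 is a point, of mass 1. *)
Definition halfpow (k : nat) (s : R) : R :=
  if (0 <= s)%R then (Num.sqrt s ^+ k)%R else 0%R.

Lemma halfpow_ge0 k s : (0 <= halfpow k s)%R.
Proof. by rewrite /halfpow; case: ifP => // _; rewrite exprn_ge0. Qed.

Lemma halfpow_homo k : {homo halfpow k : x y / (x <= y)%R}.
Proof.
move=> x y xy; rewrite {1}/halfpow; case: ifPn => [x0|_]; last exact: halfpow_ge0.
rewrite /halfpow (le_trans x0 xy) lerXn2r ?nnegrE ?sqrtr_ge0//.
by rewrite ler_sqrt// (le_trans x0).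
Qed.

Lemma measurable_halfpow k : measurable_fun [set: R] (halfpow k).
Proof. by apply: nondecreasing_measurable => // x y; exact: halfpow_homo. Qed.

Lemma halfpowM k s x : (0 < s)%R -> halfpow k (s * x) = (Num.sqrt s ^+ k * halfpow k x)%R.
Proof.
move=> s0; rewrite /halfpow pmulr_rge0//; case: ifPn => x0; last by rewrite mulr0.
by rewrite sqrtrM ?(ltW s0)// exprMn.
Qed.

Lemma measurable_halfpow_subsqr k (s : R) :
  measurable_fun [set: R] (fun y : R => halfpow k (s - y ^+ 2)).
Proof.
apply: measurableT_comp; first exact: measurable_halfpow.
by apply: measurable_funB => //; apply: measurable_funX.
Qed.

(** The integrand vanishes outside the interval of radius sqrt s and is at most
sqrt s ^ k there.  This bound gives the finiteness of [ball_ratio], the estimate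
omega_k <= 2^k, and the degenerate case s = 0 of [integral_halfpow]. *)
Lemma integral_halfpow_le k (s : R) : (0 <= s)%R ->
  \int[mu]_y (halfpow k (s - y ^+ 2))%:E <= (Num.sqrt s ^+ k * (2 * Num.sqrt s))%:E.
Proof.
move=> s0; set r := Num.sqrt s; have r0 : (0 <= r)%R by exact: sqrtr_ge0.
apply: (@le_trans _ _ (\int[mu]_y ((r ^+ k)%:E * (\1_(`[- r, r]%classic) y)%:E))).
  apply: ge0_le_integral => //=.
  - by move=> y _; rewrite lee_fin halfpow_ge0.
  - apply/measurable_EFinP; exact: measurable_halfpow_subsqr.
  - by apply: measurable_funeM; apply/measurable_EFinP; exact: measurable_indic.
  move=> y _; rewrite -EFinM lee_fin indicE mem_setE in_itv/= -ler_norml.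
  have -> : (`|y| <= r)%R = (0 <= s - y ^+ 2)%R.
    by rewrite subr_ge0 -sqrtr_sqr ler_sqrt.
  rewrite {1}/halfpow; case: ifP => _; last by rewrite mulr0.
  by rewrite mulr1 lerXn2r ?nnegrE ?sqrtr_ge0// ler_wsqrtr// gerBl sqr_ge0.
rewrite ge0_integralZl//; last 2 first.
- apply/measurable_EFinP; exact: measurable_indic.
- by rewrite lee_fin exprn_ge0.
rewrite integral_indic//= setIT lebesgue_measure_itv/= lte_fin EFinM.
rewrite lee_wpmul2l ?lee_fin ?exprn_ge0//; case: ifPn => _.
  by rewrite -EFinB opprK mulr2n mulrDl mul1r.
by rewrite lee_fin mulr_ge0.
Qed.

(** The ratio omega_(k+1) / omega_k: slicing the unit ball of dimension k+1 at
height y leaves a ball of dimension k and squared radius 1 - y^2. *)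
Definition ball_ratio (k : nat) : R :=
  fine (\int[mu]_y (halfpow k (1 - y ^+ 2))%:E).

Lemma ball_ratioE k :
  (ball_ratio k)%:E = \int[mu]_y (halfpow k (1 - y ^+ 2))%:E.
Proof.
have I0 : 0 <= \int[mu]_y (halfpow k (1 - y ^+ 2))%:E.
  by apply: integral_ge0 => y _; rewrite lee_fin halfpow_ge0.
rewrite /ball_ratio fineK// ge0_fin_numE//.
exact: le_lt_trans (integral_halfpow_le k _ ler01) (ltry _).
Qed.

Lemma ball_ratio_ge0 k : (0 <= ball_ratio k)%R.
Proof. by rewrite fine_ge0// integral_ge0// => y _; rewrite lee_fin halfpow_ge0. Qed.

Lemma ball_ratio_le2 k : (ball_ratio k <= 2)%R.
Proof.
rewrite -lee_fin ball_ratioE (le_trans (integral_halfpow_le k _ ler01))//.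
by rewrite sqrtr1 expr1n mul1r mulr1.
Qed.

(** Homogeneity: the substitution y = sqrt s * z takes s - y^2 to s (1 - z^2). *)
Lemma integral_halfpow k (s : R) :
  \int[mu]_y (halfpow k (s - y ^+ 2))%:E = (ball_ratio k * halfpow k.+1 s)%:E.
Proof.
have [s0|s0|<-] := ltgtP 0%R s.
- rewrite (@ge0_integral_affine _ (Num.sqrt s) 0) ?sqrtr_gt0//; last 2 first.
  + apply/measurable_EFinP; exact: measurable_halfpow_subsqr.
  + by move=> y; rewrite lee_fin halfpow_ge0.
  under eq_integral => y _.
    rewrite addr0 exprMn sqr_sqrtr ?(ltW s0)//.
    rewrite -[X in (X - _)%R]mulr1 -mulrBr halfpowM// EFinM.
    over.
  rewrite ge0_integralZl//; last 2 first.
  + apply/measurable_EFinP; exact: measurable_halfpow_subsqr.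
  + by move=> y _; rewrite lee_fin halfpow_ge0.
  rewrite -ball_ratioE -!EFinM /halfpow (ltW s0); congr EFin.
  by rewrite exprS; ring.
- rewrite integral0_eq; last first.
    by move=> y _; rewrite /halfpow lt_geF// subr_lt0 (lt_le_trans s0)// sqr_ge0.
  by rewrite /halfpow lt_geF// mulr0.
- apply/eqP; rewrite /halfpow lexx sqrtr0 expr0n/= mulr0 eq_le; apply/andP; split.
    have := integral_halfpow_le k 0%R (lexx _).
    by rewrite sqrtr0 !mulr0.
  by apply: integral_ge0 => y _; rewrite lee_fin halfpow_ge0.
Qed.

(** The volume omega_k of the unit ball, by slicing. *)
Fixpoint ball_vol (k : nat) : R :=
  if k is k'.+1 then (ball_ratio k' * ball_vol k')%R else 1%R.

Lemma ball_vol_ge0 k : (0 <= ball_vol k)%R.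
Proof. by elim: k => //= k ih; rewrite mulr_ge0 ?ball_ratio_ge0. Qed.

Lemma ball_vol_le k : (ball_vol k <= 2 ^+ k)%R.
Proof.
elim: k => [|k ih]; first by rewrite expr0.
by rewrite exprS ler_pM ?ball_ratio_ge0 ?ball_vol_ge0 ?ball_ratio_le2.
Qed.

(** Tonelli's theorem followed by the translation s = u + phi y in the inner
integral.  With phi y = y^2 it relates the balls of dimensions k and k+1; with
phi y = y and h the indicator of the half-line it relates consecutive powers. *)
Lemma laplace_convolution (h phi f : R -> R) :
  measurable_fun [set: R] h -> measurable_fun setT phi -> measurable_fun setT f ->
  (forall y, 0 <= h y)%R -> (forall s, 0 <= f s)%R ->
  \int[mu]_s ((expR (- s))%:E * \int[mu]_y (h y * f (s - phi y))%:E) =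
  \int[mu]_y (h y * expR (- phi y))%:E * \int[mu]_u (expR (- u) * f u)%:E.
Proof.
move=> mh mphi mf h0 f0.
pose F (p : measurableTypeR R * measurableTypeR R) : \bar R :=
  (expR (- p.1) * (h p.2 * f (p.1 - phi p.2)))%:E.
have mexp : measurable_fun [set: R] (fun s : R => expR (- s)).
  by apply: measurableT_comp => //; exact: measurable_funN.
have mF : measurable_fun setT F.
  apply/measurable_EFinP; apply: measurable_funM.
    by apply: (measurableT_comp mexp); exact: measurable_fst.
  apply: measurable_funM; first by apply: (measurableT_comp mh); exact: measurable_snd.
  apply: (measurableT_comp mf); apply: measurable_funB; first exact: measurable_fst.
  by apply: (measurableT_comp mphi); exact: measurable_snd.
have F0 p : 0 <= F p by rewrite lee_fin mulr_ge0 ?expR_ge0// mulr_ge0.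
transitivity (\int[mu]_s \int[mu]_y F (s, y)).
  apply: eq_integral => s _; rewrite -ge0_integralZl//.
  - apply/measurable_EFinP; apply: measurable_funM => //.
    by apply: (measurableT_comp mf); apply: measurable_funB.
  - by move=> y _; rewrite lee_fin mulr_ge0.
rewrite fubini_tonelli// -ge0_integralZr//; last 3 first.
- apply/measurable_EFinP; apply: measurable_funM => //.
  by apply: (measurableT_comp mexp).
- by move=> y _; rewrite lee_fin mulr_ge0 ?expR_ge0.
- by apply: integral_ge0 => u _; rewrite lee_fin mulr_ge0 ?expR_ge0.
apply: eq_integral => y _.
rewrite (@ge0_integral_affine (fun u => (expR (- u) * f u)%:E) 1 (- phi y))//; last 2 first.
- by apply/measurable_EFinP; apply: measurable_funM.
- by move=> u; rewrite lee_fin mulr_ge0 ?expR_ge0.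
rewrite mul1e -ge0_integralZl//; last 3 first.
- apply/measurable_EFinP; apply: measurable_funM.
    by apply: (measurableT_comp mexp); apply: measurable_funD => //; apply: measurable_funM.
  by apply: (measurableT_comp mf); apply: measurable_funD => //; apply: measurable_funM.
- by move=> u _; rewrite lee_fin mulr_ge0 ?expR_ge0.
- by rewrite lee_fin mulr_ge0 ?expR_ge0.
apply: eq_integral => s _; rewrite -EFinM mul1r; congr EFin.
have -> : expR (- s) = (expR (- phi y) * expR (- (s - phi y)))%R.
  by rewrite -expRD; congr expR; ring.
ring.
Qed.

End RealIntegrals.

(** * Values of the Gamma function *)

Section GammaValues.
Variable R : realType.
Local Notation mu := (@lebesgue_measure R).
Local Open Scope ereal_scope.

(** The extended real number Gamma(k/2 + 1), see [Gamma_halfpow]; its finiteness is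
only known after [ball_vol_laplace]. *)
Definition halfpow_laplace (k : nat) : \bar R :=
  \int[mu]_u (expR (- u) * halfpow R k u)%:E.

Let measurable_expRN : measurable_fun [set: R] (fun s : R => expR (- s)).
Proof. by apply: measurableT_comp => //; exact: measurable_funN. Qed.

Let measurable_laplace_halfpow k :
  measurable_fun [set: R] (fun u : R => (expR (- u) * halfpow R k u)%:E).
Proof.
by apply/measurable_EFinP; apply: measurable_funM => //; exact: measurable_halfpow.
Qed.

Let laplace_halfpow_ge0 k (u : R) : 0 <= (expR (- u) * halfpow R k u)%:E.
Proof. by rewrite lee_fin mulr_ge0 ?expR_ge0 ?halfpow_ge0. Qed.

(** The convolution identity with phi y = y^2, where the factor sqrt(pi) is the
Gaussian integral. *)
Lemma halfpow_laplace_gauss k :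
  (Num.sqrt pi)%:E * halfpow_laplace k =
  (ball_ratio R k)%:E * halfpow_laplace k.+1.
Proof.
have := @laplace_convolution R (fun=> 1%R) (fun y => y ^+ 2)%R (halfpow R k)
  (measurable_cst _) (measurable_funX 2 (@measurable_id _ _ _)) (measurable_halfpow R k)
  (fun=> ler01) (halfpow_ge0 R k).
have -> : \int[mu]_y (1 * expR (- y ^+ 2))%:E = (Num.sqrt pi)%:E.
  by rewrite -integralT_gauss; apply: eq_integral => y _; rewrite mul1r.
move=> <-.
rewrite -[RHS]ge0_integralZl//; last 2 first.
- exact: measurable_laplace_halfpow.
- by rewrite lee_fin ball_ratio_ge0.
apply: eq_integral => s _.
under eq_integral do rewrite mul1r.
by rewrite integral_halfpow -!EFinM mulrCA.
Qed.

(** For s >= 0 the integral is that of (s - y)^l over [0, s]; scaling by s reduces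
it to the unit interval. *)
Lemma integral_halfpow_double l (s : R) :
  \int[mu]_y (\1_(`[0%R, +oo[%classic) y * halfpow R l.*2 (s - y))%:E =
  (l.+1%:R^-1 * halfpow R l.+1.*2 s)%:E.
Proof.
have I0 (x : R) : \1_(`[0%R, +oo[%classic) x = (0 <= x)%R%:R :> R.
  by rewrite indicE mem_setE in_itv/= andbT.
have m0 (r : R) : measurable_fun [set: R]
    (fun y => \1_(`[0%R, +oo[%classic) y * halfpow R l.*2 (r - y))%R.
  apply: measurable_funM; first exact: measurable_indic.
  by apply: (measurableT_comp (measurable_halfpow R _)); exact: measurable_funB.
have ge0 (r y : R) : (0 <= \1_(`[0%R, +oo[%classic) y * halfpow R l.*2 (r - y))%R.
  by rewrite mulr_ge0 ?halfpow_ge0// I0.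
have [s0|s0|<-] := ltgtP 0%R s.
- rewrite (@ge0_integral_affine _ _ s 0)//; last 2 first.
  + by apply/measurable_EFinP; exact: m0.
  + by move=> y; rewrite lee_fin.
  under eq_integral => y _.
    rewrite addr0 -[X in (X - _)%R]mulr1 -mulrBr halfpowM// mulrCA EFinM.
    rewrite I0 pmulr_rge0// -I0.
    over.
  rewrite ge0_integralZl//; last 2 first.
  + by apply/measurable_EFinP; exact: m0.
  + by move=> y _; rewrite lee_fin.
  have -> : \int[mu]_y (\1_(`[0%R, +oo[%classic) y * halfpow R l.*2 (1 - y))%:E =
      (l.+1%:R^-1)%:E.
    (* The real integral is nonzero, so the extended one is finite. *)
    rewrite -Rintegral_onemXn /Rintegral fineK; last first.
      have := @Rintegral_onemXn R l; rewrite /Rintegral.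
      case: (\int[_]_(_ in _) _) => //= /esym/eqP; by rewrite invr_eq0 pnatr_eq0.
    rewrite [RHS]integral_mkcond; apply: eq_integral => y _.
    rewrite patchE mem_setE in_itv/= I0 /halfpow subr_ge0.
    case: (0 <= y)%R; rewrite ?mul0r// mul1r; case: ifP => // y1.
    by rewrite -mul2n exprM sqr_sqrtr// subr_ge0.
  rewrite -!EFinM; congr EFin; rewrite /halfpow (ltW s0).
  rewrite doubleS !exprS (_ : l.*2 = (2 * l)%N) ?mul2n//.
  by rewrite -{1}(sqr_sqrtr (ltW s0)); ring.
- rewrite integral0_eq; last first.
    move=> y _; rewrite I0; have [y0|y0] := leP 0%R y; last by rewrite mul0r.
    by rewrite /halfpow lt_geF ?mulr0// subr_lt0 (lt_le_trans s0).
  by rewrite /halfpow lt_geF// mulr0.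
- rewrite /halfpow lexx sqrtr0 expr0n/= mulr0.
  apply: etrans (integral_set1
    (fun y => (\1_(`[0%R, +oo[%classic) y * halfpow R l.*2 (0 - y))%:E) 0%R).
  rewrite [RHS]integral_mkcond; apply: eq_integral => y _; rewrite patchE.
  have -> : (y \in [set 0%R]) = (y == 0%R) by apply/idP/eqP => [|->]; rewrite inE.
  rewrite I0 /halfpow sub0r oppr_ge0.
  have [y0|y0|<-] := ltgtP 0%R y; rewrite ?eqxx ?mul0r ?mulr0//=.
Qed.

(** The exponential density has mass 1, so the convolution identity with
phi y = y is the functional equation Gamma(l+2) = (l+1) Gamma(l+1). *)
Lemma halfpow_laplace_double l : halfpow_laplace l.*2 = (l`!%:R)%:E.
Proof.
have exp1 : \int[mu]_y (\1_(`[0%R, +oo[%classic) y * expR (- y))%:E = 1.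
  rewrite -(@integral_exponential_pdf R 1 ltr01); apply: eq_integral => y _.
  by rewrite /exponential_pdf patchE indicE; case: (y \in _);
    rewrite ?mul0r// !mul1r mulN1r.
elim: l => [|l ih].
  rewrite fact0 -[RHS]exp1; apply: eq_integral => u _.
  rewrite mulrC indicE mem_setE in_itv/= andbT /halfpow.
  by case: (0 <= u)%R; rewrite ?expr0.
have m1 : measurable_fun [set: R] (\1_(`[0%R, +oo[%classic) : R -> R).
  exact: measurable_indic.
have h0 (y : R) : (0 <= \1_(`[0%R, +oo[%classic) y :> R)%R by rewrite indicE.
have := @laplace_convolution R (\1_(`[0%R, +oo[%classic)) id (halfpow R l.*2)
  m1 (@measurable_id _ _ _) (measurable_halfpow R _)
  h0 (halfpow_ge0 R _).
rewrite exp1 mul1e -/(halfpow_laplace _) ih => convE.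
rewrite factS natrM EFinM -convE.
under eq_integral => s _.
  rewrite integral_halfpow_double -EFinM mulrCA EFinM.
  over.
rewrite ge0_integralZl//; last exact: measurable_laplace_halfpow.
by rewrite muleA -EFinM divff ?pnatr_eq0// mul1e.
Qed.

(** The product omega_k Gamma(k/2+1) is multiplied by sqrt(pi) at each step, because
omega_(k+1) = [ball_ratio k] * omega_k and [halfpow_laplace_gauss] moves this ratio
to the other factor. *)
Lemma ball_vol_laplace k :
  (ball_vol R k)%:E * halfpow_laplace k = (Num.sqrt pi ^+ k)%:E.
Proof.
elim: k => [|k ih].
  by rewrite mul1e expr0 (halfpow_laplace_double 0) fact0.
transitivity ((ball_vol R k)%:E * (ball_ratio R k)%:E * halfpow_laplace k.+1).
  by congr (_ * _); rewrite -EFinM mulrC.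
rewrite -muleA -halfpow_laplace_gauss muleCA ih -EFinM.
by rewrite exprS.
Qed.

Lemma Gamma_halfpow k : Gamma (k%:R / 2 + 1 : R) = fine (halfpow_laplace k).
Proof.
rewrite /Gamma /Rintegral; congr fine.
rewrite addrK.
transitivity (\int[mu]_(u in `]0%R, +oo[) (expR (- u) * halfpow R k u)%:E).
  apply: eq_integral => u; rewrite inE/= in_itv/= andbT => u0.
  rewrite mulrC /halfpow (ltW u0); congr (_ * _)%:E.
  by rewrite mulrC powRrM powR12_sqrt ?(ltW u0)// powR_mulrn ?sqrtr_ge0.
rewrite integral_itv_obnd_cbnd; last exact: measurable_funTS.
rewrite integral_mkcond; apply: eq_integral => u _.
rewrite patchE mem_setE in_itv/= andbT /halfpow.
by case: (0 <= u)%R; rewrite ?mulr0.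
Qed.

Lemma Gamma_fact l : Gamma (l%:R + 1 : R) = l`!%:R.
Proof.
have -> : (l%:R + 1 = l.*2%:R / 2 + 1 :> R)%R.
  by rewrite -muln2 natrM mulfK// pnatr_eq0.
by rewrite Gamma_halfpow halfpow_laplace_double.
Qed.

(** The product [ball_vol_laplace] is finite and nonzero, which excludes both
omega_k = 0 and an infinite value of Euler's integral. *)
Lemma ball_vol_Gamma k :
  ball_vol R k = (Num.sqrt pi ^+ k / Gamma (k%:R / 2 + 1 : R))%R.
Proof.
have sp : (Num.sqrt pi ^+ k != 0 :> R)%R.
  by rewrite expf_neq0// gt_eqF// sqrtr_gt0 pi_gt0.
have := ball_vol_laplace k; rewrite Gamma_halfpow.
have [v0|v0] := eqVneq (ball_vol R k) 0%R.
  by rewrite v0 mul0e; case=> /esym/eqP; rewrite (negbTE sp).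
have vp : (0 < ball_vol R k)%R by rewrite lt_neqAle eq_sym v0 ball_vol_ge0.
case: (halfpow_laplace k) => [g| |]; last 2 first.
- by rewrite gt0_muley.
- by rewrite gt0_muleNy.
rewrite -EFinM; case=> vg; rewrite /= -vg mulfK//.
by apply/eqP => g0; move: sp; rewrite -vg g0 mulr0 eqxx.
Qed.

End GammaValues.

(** * Iterated Lebesgue measure of the tube of a cube *)

Section CubeTubeVolume.
Variables (R : realType) (rho : R).
Hypothesis rho0 : 0 < rho.
Local Notation mu := (@lebesgue_measure R).

(** The distance from x to the interval [-rho, rho]. *)
Definition excess (x : R) : R := Num.max 0 (`|x| - rho).

Lemma measurable_excess_sqr : measurable_fun [set: R] (fun x => excess x ^+ 2).
Proof.
apply: measurable_funX; apply: measurable_maxr => //.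
by apply: measurable_funB => //; exact: normr_measurable.
Qed.

(** The interval ]-rho, rho] contributes its length times f 0; the two half-lines
outside, translated by rho, make up the whole line.  Assigning the point 0 to
exactly one of the half-lines makes the decomposition exact, not only almost
everywhere. *)
Lemma integral_excess (f : R -> R) : measurable_fun [set: R] f ->
  (forall s, 0 <= f s) ->
  (\int[mu]_x (f (excess x ^+ 2))%:E =
   (2 * rho * f 0)%:E + \int[mu]_y (f (y ^+ 2))%:E)%E.
Proof.
move=> mf f0.
have mfsqr : measurable_fun [set: R] (fun y : R => f (y ^+ 2)).
  by apply: (measurableT_comp mf); exact: measurable_funX.
pose hp (y : R) : R := if 0 < y then f (y ^+ 2) else 0.
pose hn (y : R) : R := if y <= 0 then f (y ^+ 2) else 0.
pose I x : R := f 0 * \1_(`](- rho), rho]%classic) x.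
have mhp : measurable_fun [set: R] hp.
  by apply: measurable_fun_ifT => //; exact: measurable_fun_ltr.
have mhn : measurable_fun [set: R] hn.
  by apply: measurable_fun_ifT => //; exact: measurable_fun_ler.
have hp0 y : 0 <= hp y by rewrite /hp; case: ifP.
have hn0 y : 0 <= hn y by rewrite /hn; case: ifP.
have I0 y : 0 <= I y by rewrite /I mulr_ge0// indicE.
have mI : measurable_fun [set: R] I by apply: measurable_funM => //; exact: measurable_indic.
have fE x : f (excess x ^+ 2) = I x + (hp (x - rho) + hn (x + rho)).
  rewrite /I /hp /hn /excess indicE mem_setE in_itv/= subr_gt0.
  have [xr|rx] := leP x rho; last first.
    have x0 : 0 < x by exact: lt_trans rx.
    rewrite gtr0_norm// max_r; last by rewrite subr_ge0 ltW.
    rewrite andbF mulr0 add0r ifF ?addr0//.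
    by apply/negbTE; rewrite -ltNge addr_gt0.
  have [nrx|xnr] := ltP (- rho) x.
    rewrite max_l ?expr0n/=; last by rewrite subr_le0 ler_norml xr ltW.
    rewrite mulr1 add0r ifF ?addr0//.
    by apply/negbTE; rewrite -ltNge -ltrBlDr sub0r.
  have x0 : x <= 0 by rewrite (le_trans xnr)// oppr_le0 ltW.
  rewrite ler0_norm// max_r; last by rewrite subr_ge0 lerNr.
  rewrite mulr0 !add0r ifT; last by rewrite -lerBrDr sub0r.
  by rewrite -opprD sqrrN.
under eq_integral do rewrite fE !EFinD.
rewrite ge0_integralD//; last 4 first.
- by move=> x _; rewrite lee_fin.
- exact/measurable_EFinP.
- by move=> x _; rewrite -EFinD lee_fin addr_ge0.
- apply/measurable_EFinP; apply: measurable_funD.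
    by apply: (measurableT_comp mhp); exact: measurable_funB.
  by apply: (measurableT_comp mhn); exact: measurable_funD.
congr (_ + _)%E.
  rewrite /I; under eq_integral do rewrite EFinM.
  rewrite ge0_integralZl//; last 2 first.
  - by apply/measurable_EFinP; exact: measurable_indic.
  - by rewrite lee_fin.
  rewrite integral_indic//= setIT lebesgue_measure_itv/= lte_fin gtrN//.
  by rewrite -EFinB -EFinM opprK; congr EFin; ring.
rewrite ge0_integralD//; last 4 first.
- by move=> x _; rewrite lee_fin.
- by apply/measurable_EFinP; apply: (measurableT_comp mhp); exact: measurable_funB.
- by move=> x _; rewrite lee_fin.
- by apply/measurable_EFinP; apply: (measurableT_comp mhn); exact: measurable_funD.
have shift (h : R -> R) b : measurable_fun [set: R] h -> (forall y, 0 <= h y) ->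
    (\int[mu]_x (h (x + b))%:E = \int[mu]_y (h y)%:E)%E.
  move=> mh h0; rewrite [RHS](@ge0_integral_affine _ _ 1 b)//.
  - by rewrite mul1e; under [RHS]eq_integral do rewrite mul1r.
  - exact/measurable_EFinP.
rewrite !shift// -ge0_integralD//; last 4 first.
- by move=> x _; rewrite lee_fin.
- exact/measurable_EFinP.
- by move=> x _; rewrite lee_fin.
- exact/measurable_EFinP.
apply: eq_integral => y _; rewrite -EFinD /hp /hn.
by have [y0|y0] := leP y 0; rewrite ?add0r ?addr0.
Qed.

(** The volume of the tube of radius sqrt s around the cube; the squared radius
is the variable in which slicing acts by translation. *)
Definition cube_tube_vol (n : nat) (s : R) : R :=
  \sum_(k < n.+1) 'C(n, k)%:R * (2 * rho) ^+ (n - k) * ball_vol R k * halfpow R k s.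

Lemma pascal_sum (r : R) (a : nat -> R) n :
  \sum_(k < n.+2) 'C(n.+1, k)%:R * r ^+ (n.+1 - k) * a k =
  r * (\sum_(k < n.+1) 'C(n, k)%:R * r ^+ (n - k) * a k) +
  \sum_(k < n.+1) 'C(n, k)%:R * r ^+ (n - k) * a k.+1.
Proof.
rewrite big_ord_recl /= bin0.
under eq_bigr => k _ do rewrite /bump /= add1n binS natrD subSS !mulrDl.
rewrite big_split/= addrA; congr (_ + _).
rewrite big_ord_recr/= bin_small// !mul0r addr0.
rewrite [in RHS]big_ord_recl/= bin0 mulrDr !subn0 exprS !mul1r mulrA; congr (_ + _).
rewrite mulr_sumr; apply: eq_bigr => k _; rewrite /bump/= add1n.
by rewrite -{1}(subnSK (ltn_ord k)) exprS; ring.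
Qed.

Lemma cube_tube_volS n s :
  cube_tube_vol n.+1 s = 2 * rho * cube_tube_vol n s +
    \sum_(k < n.+1) 'C(n, k)%:R * (2 * rho) ^+ (n - k) * ball_vol R k.+1 * halfpow R k.+1 s.
Proof.
rewrite /cube_tube_vol.
under eq_bigr do rewrite -mulrA.
rewrite (pascal_sum (2 * rho) (fun k => ball_vol R k * halfpow R k s)).
by congr (_ * _ + _); apply: eq_bigr => k _; rewrite mulrA.
Qed.

Let coef_ge0 n k : 0 <= 'C(n, k)%:R * (2 * rho) ^+ (n - k) * ball_vol R k.
Proof.
by rewrite mulr_ge0 ?ball_vol_ge0// mulr_ge0// exprn_ge0// mulr_ge0// ltW.
Qed.

Lemma measurable_cube_tube_vol n : measurable_fun [set: R] (cube_tube_vol n).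
Proof.
apply: measurable_sum => k; apply: measurable_funM => //.
exact: measurable_halfpow.
Qed.

Lemma cube_tube_vol_ge n s : 0 <= s -> (2 * rho) ^+ n <= cube_tube_vol n s.
Proof.
move=> s0; rewrite /cube_tube_vol big_ord_recl bin0 subn0 mul1r /halfpow s0.
rewrite expr0 !mulr1 lerDl sumr_ge0// => k _.
by rewrite mulr_ge0// exprn_ge0.
Qed.

Lemma cube_tube_vol_ge0 n s : 0 <= cube_tube_vol n s.
Proof. by rewrite sumr_ge0// => k _; rewrite mulr_ge0// halfpow_ge0. Qed.

(** One step of slicing, matched with Pascal's rule: the first term of
[integral_excess] keeps the dimension of the ball, the second raises it. *)
Lemma integral_cube_tube_vol n s :
  (\int[mu]_x (cube_tube_vol n (s - excess x ^+ 2))%:E = (cube_tube_vol n.+1 s)%:E)%E.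
Proof.
rewrite (@integral_excess (fun t => cube_tube_vol n (s - t))); last 2 first.
- by apply: (measurableT_comp (measurable_cube_tube_vol n)); exact: measurable_funB.
- by move=> t; exact: cube_tube_vol_ge0.
rewrite subr0 cube_tube_volS EFinD; congr (_ + _)%E.
rewrite /cube_tube_vol; under eq_integral do rewrite -sumEFin.
rewrite ge0_integral_sum//; last 2 first.
- move=> k; apply/measurable_EFinP; apply: measurable_funM => //.
  exact: measurable_halfpow_subsqr.
- by move=> k y _; rewrite lee_fin mulr_ge0// halfpow_ge0.
rewrite -sumEFin; apply: eq_bigr => k _.
under eq_integral do rewrite EFinM.
rewrite ge0_integralZl//; last 3 first.
- by apply/measurable_EFinP; exact: measurable_halfpow_subsqr.
- by move=> y _; rewrite lee_fin halfpow_ge0.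
- by rewrite lee_fin.
by rewrite integral_halfpow -EFinM /=; congr EFin; ring.
Qed.

Lemma lebesgue_tupleS n (A : set (n.+1.-tuple (measurableTypeR R))) :
  lebesgue_tuple A = (\int[mu]_x lebesgue_tuple
     [set u : n.-tuple (measurableTypeR R) | A [tuple of x :: u]])%E.
Proof.
rewrite /= /pushforward /product_measure1; apply: eq_integral => x _ /=.
by congr lebesgue_tuple; apply/seteqP; split => u /=; rewrite /xsection/= inE.
Qed.

Definition excess_sum {n : nat} (u : n.-tuple (measurableTypeR R)) : R :=
  \sum_(i < n) excess (tnth u i) ^+ 2.

Lemma excess_sum_cons n x (u : n.-tuple (measurableTypeR R)) :
  excess_sum [tuple of x :: u] = excess x ^+ 2 + excess_sum u.
Proof.
rewrite /excess_sum big_ord_recl tnth0; congr (_ + _).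
by apply: eq_bigr => i _; rewrite tnthS.
Qed.

(** The slice of the set at x is the same set in one dimension less, with s replaced
by s - (excess x)^2. *)
Lemma lebesgue_excess_le n s :
  lebesgue_tuple [set u : n.-tuple (measurableTypeR R) | excess_sum u <= s] =
  (cube_tube_vol n s)%:E.
Proof.
elim: n s => [|n ih] s.
  rewrite /= diracE /cube_tube_vol big_ord1 bin0 subnn !expr0 !mul1r /halfpow expr0.
  have -> : ([tuple] \in [set u : 0.-tuple (measurableTypeR R) | excess_sum u <= s]) = (0 <= s).
    by apply/idP/idP; rewrite inE/= /excess_sum big_ord0.
  by case: (0 <= s).
rewrite lebesgue_tupleS -integral_cube_tube_vol; apply: eq_integral => x _.
rewrite -ih; congr lebesgue_tuple.
by apply/seteqP; split=> u /=; rewrite excess_sum_cons lerBrDl.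
Qed.

(** The slice at x is again a shell when |x| < r, and the slice of the full tube
otherwise.  Integrating, the subtracted part is (2r)^n over an interval of
length 2r; it is moved to the other side of the equation so that only
nonnegative functions are integrated. *)
Lemma lebesgue_excess_shell n s r : 0 < r < rho -> 0 <= s ->
  lebesgue_tuple [set u : n.-tuple (measurableTypeR R) |
    excess_sum u <= s /\ ~ (forall i, `|tnth u i : R| < r)] =
  (cube_tube_vol n s - (2 * r) ^+ n)%:E.
Proof.
move=> /andP[r0 rr] s0; elim: n => [|n ih].
  rewrite (_ : [set _ | _] = set0); last first.
    by apply/seteqP; split=> // u /= [_]; apply; case.
  rewrite /= diracE in_set0 /cube_tube_vol big_ord1 bin0 subnn !expr0 !mul1r.
  by rewrite /halfpow s0 expr0 subrr.
rewrite lebesgue_tupleS.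
transitivity (\int[mu]_x (cube_tube_vol n (s - excess x ^+ 2) -
    (2 * r) ^+ n * \1_(`](- r), r[%classic) x)%:E)%E.
  apply: eq_integral => x _.
  rewrite indicE mem_setE in_itv/= -ltr_norml.
  have [xr|rx] := ltP `|x| r.
    have ex0 : excess x = 0 by rewrite /excess max_l// subr_le0 ltW// (lt_trans xr).
    rewrite ex0 expr0n subr0 mulr1 -ih; congr lebesgue_tuple.
    apply/seteqP; split=> u /=; rewrite excess_sum_cons ex0 expr0n add0r => -[us ur].
      split=> // h; apply: ur => i; have [j ->|->] := unliftP ord0 i.
        by rewrite tnthS.
      by rewrite tnth0.
    by split=> // h; apply: ur => i; have := h (lift ord0 i); rewrite tnthS.
  rewrite mulr0 subr0 -lebesgue_excess_le; congr lebesgue_tuple.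
  apply/seteqP; split=> u /=; rewrite excess_sum_cons lerBrDl; first by case.
  by move=> us; split=> // /(_ ord0); rewrite tnth0 ltNge rx.
have mI : measurable_fun [set: R]
    (fun x => (2 * r) ^+ n * \1_(`](- r), r[%classic) x).
  by apply: measurable_funM => //; exact: measurable_indic.
have mV : measurable_fun [set: R] (fun x => cube_tube_vol n (s - excess x ^+ 2)).
  apply: (measurableT_comp (measurable_cube_tube_vol n)).
  by apply: measurable_funB => //; exact: measurable_excess_sqr.
have r20 : 0 <= 2 * r by rewrite mulr_ge0// ltW.
have II : (\int[mu]_x ((2 * r) ^+ n * \1_(`](- r), r[%classic) x)%:E = ((2 * r) ^+ n.+1)%:E)%E.
  under eq_integral do rewrite EFinM.
  rewrite ge0_integralZl//; last 2 first.
  - by apply/measurable_EFinP; exact: measurable_indic.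
  - by rewrite lee_fin exprn_ge0.
  rewrite integral_indic//= setIT lebesgue_measure_itv/= lte_fin gtrN//.
  by rewrite -EFinB -EFinM opprK exprS; congr EFin; ring.
have ge x : 0 <= cube_tube_vol n (s - excess x ^+ 2) -
    (2 * r) ^+ n * \1_(`](- r), r[%classic) x.
  rewrite subr_ge0 indicE mem_setE in_itv/= -ltr_norml.
  have [xr|rx] := ltP `|x| r; last by rewrite mulr0 cube_tube_vol_ge0.
  have -> : excess x = 0 by rewrite /excess max_l// subr_le0 ltW// (lt_trans xr).
  rewrite expr0n subr0 mulr1 (le_trans _ (cube_tube_vol_ge _ _ s0))//.
  by rewrite lerXn2r ?nnegrE ?mulr_ge0 ?ltW// ltr_pM2l.
set J := LHS.
have JE : (J + ((2 * r) ^+ n.+1)%:E = (cube_tube_vol n.+1 s)%:E)%E.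
  rewrite -II /J -ge0_integralD//; last 4 first.
  - by move=> x _; rewrite lee_fin.
  - by apply/measurable_EFinP; exact: measurable_funB.
  - by move=> x _; rewrite lee_fin mulr_ge0 ?exprn_ge0// indicE.
  - exact/measurable_EFinP.
  rewrite -integral_cube_tube_vol; apply: eq_integral => x _.
  by rewrite -EFinD subrK.
by rewrite EFinB -JE addeK.
Qed.

End CubeTubeVolume.

(** * Geometry of the tubes of a cube and of its boundary *)

Section CubeGeometry.
Variables (R : realType) (n : nat) (rho : R).
Hypothesis rho0 : 0 < rho.
Implicit Types (x a : 'rV[R]_n) (A : set 'rV[R]_n) (t : R).

Lemma tubeP A t x : 0 < t ->
  tube A t x <-> exists2 a, A a & \sum_i (x 0 i - a 0 i) ^+ 2 <= t ^+ 2.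
Proof.
move=> t0; split=> [[a Aa [b]]|[a Aa xa]].
  rewrite /unit_ball /= => b1 <-; exists a => //.
  under eq_bigr do rewrite !mxE addrAC subrr add0r exprMn.
  by rewrite -mulr_sumr ler_piMr// sqr_ge0.
exists a => //; exists (t^-1 *: (x - a)); last first.
  by rewrite scalerA divff ?gt_eqF// scale1r addrC subrK.
rewrite /unit_ball /=; under eq_bigr do rewrite !mxE exprMn.
by rewrite -mulr_sumr exprVn ler_pdivrMl ?exprn_gt0// mulr1.
Qed.

Lemma excess_le (y a : R) : `|a| <= rho -> excess R rho y ^+ 2 <= (y - a) ^+ 2.
Proof.
move=> ar; rewrite -[leRHS]real_normK ?num_real//.
rewrite lerXn2r ?nnegrE ?le_max ?lexx// ge_max normr_ge0/=.
rewrite lerBlDr -[X in `|X| <= _](subrK a) (le_trans (ler_normD _ _))// lerD2l//.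
Qed.

(** The nearest point of the interval [-rho, rho]. *)
Definition clip (y : R) : R := if rho < y then rho else if y < - rho then - rho else y.

Lemma clip_excess (y : R) : (y - clip y) ^+ 2 = excess R rho y ^+ 2.
Proof.
rewrite /clip /excess; have [ry|yr] := ltP rho y.
  by rewrite max_r gtr0_norm ?(lt_trans rho0 ry)// subr_ge0 ltW.
have [yr'|ry] := ltP y (- rho).
  have y0 : y < 0 by rewrite (lt_trans yr')// oppr_lt0.
  rewrite ltr0_norm// max_r; last by rewrite subr_ge0 lerNr ltW.
  by rewrite -opprD sqrrN opprK.
by rewrite subrr max_l// subr_le0 ler_norml ry.
Qed.

Lemma clip_le (y : R) : `|clip y| <= rho.
Proof.
rewrite /clip; have [_|yr] := ltP rho y; first by rewrite gtr0_norm.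
have [_|ry] := ltP y (- rho); first by rewrite normrN gtr0_norm.
by rewrite ler_norml ry.
Qed.

Lemma clip_out (y : R) : rho <= `|y| -> `|clip y| = rho.
Proof.
rewrite /clip; have [_ _|yr] := ltP rho y; first by rewrite gtr0_norm.
have [_ _|ry ryn] := ltP y (- rho); first by rewrite normrN gtr0_norm.
by apply/eqP; rewrite eq_le ryn andbT ler_norml ry.
Qed.

Lemma tube_cube t x : 0 < t ->
  tube (cube n rho) t x <-> \sum_i excess R rho (x 0 i) ^+ 2 <= t ^+ 2.
Proof.
move=> t0; rewrite tubeP//; split=> [[a ca]|h].
  by apply: le_trans; apply: ler_sum => i _; exact: excess_le (ca i).
exists (\row_i clip (x 0 i)); first by move=> i; rewrite mxE clip_le.
by under eq_bigr do rewrite mxE clip_excess.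
Qed.

Lemma mx_norm_leP x (r : R) : 0 <= r -> `|x| <= r <-> forall i, `|x 0 i| <= r.
Proof.
move=> r0; rewrite -[`|x|]/(mx_norm x) mx_normrE; split.
  by move=> /bigmax_leP[_ h] i; exact: (h (0, i)).
by move=> h; apply/bigmax_leP; split=> // -[i j] _ /=; rewrite ord1.
Qed.

Lemma mx_norm_ltP x (r : R) : 0 < r -> `|x| < r <-> forall i, `|x 0 i| < r.
Proof.
move=> r0; rewrite -[`|x|]/(mx_norm x) mx_normrE; split.
  by move=> /bigmax_ltP[_ h] i; exact: (h (0, i)).
by move=> h; apply/bigmax_ltP; split=> // -[i j] _ /=; rewrite ord1.
Qed.

(** The cube is the closed ball of the sup norm, so its interior is the open
ball. *)
Lemma boundary_cube x :
  boundary (cube n rho) x <-> cube n rho x /\ ~ (forall i, `|x 0 i| < rho).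
Proof.
have cubeE : cube n rho = closed_ball (0 : 'rV[R]_n) rho.
  rewrite closed_ballE//; apply/seteqP; split => y; rewrite /closed_ball_/= sub0r normrN;
    by move/mx_norm_leP; apply; exact: ltW.
have ballE y : ball (0 : 'rV[R]_n) rho y <-> forall i, `|y 0 i| < rho.
  by rewrite -ball_normE /ball_/= sub0r normrN; exact: mx_norm_ltP.
rewrite /boundary; split=> [[]|[cx nx]].
  rewrite {1}cubeE -(closure_id _).1; last exact: closed_ball_closed.
  rewrite -cubeE => cx nx; split=> // /ballE bx; apply: nx.
  by rewrite cubeE interior_closed_ballE.
split; first exact: subset_closure.
by rewrite cubeE interior_closed_ballE// => /ballE.
Qed.

(** A boundary point within t of x keeps some coordinate of x at least rho - t.
Conversely, if x is outside the open cube its nearest point in the cube is on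
the boundary; if x is inside, pushing one coordinate of size at least rho - t
to the nearer face moves x by at most t. *)
Lemma tube_boundary_cube t x : 0 < t < rho ->
  tube (boundary (cube n rho)) t x <->
  \sum_i excess R rho (x 0 i) ^+ 2 <= t ^+ 2 /\ ~ (forall i, `|x 0 i| < rho - t).
Proof.
move=> /andP[t0 tr]; rewrite tubeP//; split=> [[a /boundary_cube[ca na] xa]|[xt nx]].
  split; first by apply/(tube_cube _ _ t0)/tubeP => //; exists a.
  move=> xr; apply: na => i; rewrite -(subrK (x 0 i) (a 0 i)).
  rewrite (le_lt_trans (ler_normD _ _))//.
  have xat : `|a 0 i - x 0 i| <= t.
    rewrite -ler_sqr ?nnegrE ?(ltW t0)// distrC real_normK ?num_real//.
    apply: le_trans xa; rewrite (bigD1 i)//= lerDl.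
    by apply: sumr_ge0 => j _; exact: sqr_ge0.
  by rewrite (le_lt_trans (lerD xat (lexx _)))// addrC -ltrBrDr.
have [inx|outx] := pselect (forall i, `|x 0 i| < rho); last first.
  exists (\row_i clip (x 0 i)); last by under eq_bigr do rewrite mxE clip_excess.
  apply/boundary_cube; split; first by move=> i; rewrite mxE clip_le.
  move=> h; apply: outx => i; rewrite ltNge; apply/negP => /clip_out xi.
  by have := h i; rewrite mxE xi ltxx.
have [i xi] : exists i, rho - t <= `|x 0 i|.
  apply: contrapT => h; apply: nx => i; rewrite ltNge; apply/negP => hi.
  by apply: h; exists i.
(* The face nearer to x in direction i. *)
pose e := if 0 <= x 0 i then rho else - rho.
have eE : `|e| = rho by rewrite /e; case: ifP; rewrite ?normrN gtr0_norm.
exists (\row_j if j == i then e else x 0 j).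
  apply/boundary_cube; split.
    by move=> j; rewrite mxE; case: ifP => _; rewrite ?eE// ltW.
  by move=> /(_ i); rewrite mxE eqxx eE ltxx.
rewrite (bigD1 i)//= mxE eqxx big1 ?addr0; last first.
  by move=> j ji; rewrite mxE (negbTE ji) subrr expr0n.
rewrite -[leLHS]real_normK ?num_real// ler_sqr ?nnegrE ?(ltW t0)//.
have := inx i; move: xi; rewrite /e.
have [x0|x0] := leP 0 (x 0 i).
  by rewrite (ger0_norm x0) => h1 h2; rewrite ler0_norm; lra.
by rewrite (ltr0_norm x0) => h1 h2; rewrite ger0_norm; lra.
Qed.

Lemma Vol_tube_cube t : 0 < t ->
  Vol (tube (cube n rho) t) = (cube_tube_vol R rho n (t ^+ 2))%:E.
Proof.
move=> t0; rewrite -lebesgue_excess_le// /Vol; congr lebesgue_tuple.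
have E (u : n.-tuple (measurableTypeR R)) :
    \sum_i excess R rho ((\row_i (tnth u i : R)) 0 i) ^+ 2 = excess_sum R rho u.
  by apply: eq_bigr => i _; rewrite mxE.
by apply/seteqP; split=> u /=; rewrite tube_cube// E.
Qed.

Lemma Vol_tube_boundary_cube t : 0 < t < rho ->
  Vol (tube (boundary (cube n rho)) t) =
  (cube_tube_vol R rho n (t ^+ 2) - (2 * (rho - t)) ^+ n)%:E.
Proof.
move=> /andP[t0 tr]; rewrite -lebesgue_excess_shell//; last 2 first.
- by rewrite subr_gt0 tr gtrBl.
- exact: sqr_ge0.
rewrite /Vol; congr lebesgue_tuple.
have E (u : n.-tuple (measurableTypeR R)) :
    \sum_i excess R rho ((\row_i (tnth u i : R)) 0 i) ^+ 2 = excess_sum R rho u.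
  by apply: eq_bigr => i _; rewrite mxE.
apply/seteqP; split=> u /=; rewrite tube_boundary_cube ?t0// E => -[us nu]; split=> // h;
  by apply: nu => i; have := h i; rewrite mxE.
Qed.

Lemma Vol_cube : Vol (cube n rho) = ((2 * rho) ^+ n)%:E.
Proof.
have -> : (2 * rho) ^+ n = cube_tube_vol R rho n 0.
  rewrite /cube_tube_vol big_ord_recl bin0 subn0 big1 ?addr0.
    by rewrite /halfpow lexx expr0 !mul1r !mulr1.
  by move=> k _; rewrite /halfpow lexx sqrtr0 expr0n mulr0.
rewrite -lebesgue_excess_le// /Vol; congr lebesgue_tuple.
apply/seteqP; split=> u /=.
  move=> cu; rewrite /excess_sum big1// => i _; have := cu i; rewrite mxE => ui.
  by rewrite /excess max_l ?expr0n// subr_le0.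
move=> us i; rewrite mxE leNgt; apply/negP => ui; move: us; apply/negP; rewrite -ltNge.
rewrite /excess_sum (bigD1 i)//= ltr_wpDr ?sumr_ge0// => [j _|]; first exact: sqr_ge0.
by rewrite exprn_gt0// lt_max subr_gt0 ui orbT.
Qed.

Definition cube_steiner_poly : {poly R} :=
  \poly_(k < n.+1) ('C(n, k)%:R * (2 * rho) ^+ (n - k) * ball_vol R k).

Lemma horner_cube_steiner_poly t : 0 <= t ->
  cube_steiner_poly.[t] = cube_tube_vol R rho n (t ^+ 2).
Proof.
move=> t0; rewrite horner_poly; apply: eq_bigr => k _.
by rewrite /halfpow sqr_ge0 sqrtr_sqr ger0_norm.
Qed.

(** The difference vanishes at 1, ..., m, where m = size (p - q) exceeds its
degree. *)
Lemma poly_eq_gt0 (p q : {poly R}) : (forall t, 0 < t -> p.[t] = q.[t]) -> p = q.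
Proof.
move=> pq; apply/eqP; rewrite -subr_eq0; apply/eqP.
pose s := [seq (i.+1%:R : R) | i <- iota 0 (size (p - q))].
apply: (@roots_geq_poly_eq0 _ _ s).
- apply/allP => _ /mapP[i _ ->]; rewrite rootE hornerD hornerN pq ?subrr//.
- rewrite map_inj_uniq ?iota_uniq// => i j /eqP; rewrite eqr_nat => /eqP[]//.
- by rewrite size_map size_iota.
Qed.

Lemma steiner_poly_cube : steiner_poly (cube n rho) = cube_steiner_poly.
Proof.
apply: poly_eq_gt0 => t t0.
have P : [set p : {poly R} | forall t, 0 < t -> Vol (tube (cube n rho) t) = p.[t]%:E]
    cube_steiner_poly.
  by move=> u u0; rewrite Vol_tube_cube// horner_cube_steiner_poly// ltW.
have := xgetPex 0 (ex_intro _ _ P) t t0.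
by rewrite -/(steiner_poly _) P// => -[].
Qed.

End CubeGeometry.

(** * Renormalized Steiner-Minkowski polynomial of the cube *)

Section CubeSteiner.
Variables (R : realType) (rho : R).
Hypothesis rho0 : 0 < rho.

Lemma ball_ratio0 : ball_ratio R 0 = 2.
Proof.
apply: EFin_inj; rewrite ball_ratioE.
transitivity (\int[@lebesgue_measure R]_y (\1_(`[(-1)%R, 1%R]%classic) y)%:E)%E.
  apply: eq_integral => y _; rewrite indicE mem_setE in_itv/= -ler_norml /halfpow expr0.
  have -> : (0 <= 1 - y ^+ 2) = (`|y| <= 1).
    by rewrite subr_ge0 -sqrtr_sqr -[X in _ = (_ <= X)]sqrtr1 ler_sqrt.
  by case: ifP.
rewrite integral_indic//= setIT lebesgue_measure_itv/= lte_fin ifT; last by lra.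
by rewrite -EFinB opprK.
Qed.

(** For small t the volume is a polynomial Q in t with Q(0) = 0, so the limit of
Q(t)/(2t) is Q'(0)/2.  The two halves of Q'(0), from the outer and the inner
side of the boundary, are equal. *)
Lemma hypersurface_area_cube n :
  hypersurface_area (boundary (cube n rho)) = (n%:R * (2 * (2 * rho) ^+ n.-1))%:E.
Proof.
pose Q : {poly R} := cube_steiner_poly R n rho - (2 *: (rho%:P - 'X)) ^+ n.
have Q0 : root Q 0.
  rewrite /root hornerD hornerN horner_cube_steiner_poly// expr0n/= horner_exp.
  rewrite hornerZ hornerD hornerN hornerC hornerX subr0.
  rewrite /cube_tube_vol big_ord_recl bin0 subn0 big1 ?addr0.
    by rewrite /halfpow lexx expr0 !mul1r !mulr1 subrr.
  by move=> k _; rewrite /halfpow lexx sqrtr0 expr0n mulr0.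
have /factor_theorem[q] := Q0; rewrite subr0 => Qq.
have Q'0 : (Q^`()).[0] = n%:R * (4 * (2 * rho) ^+ n.-1).
  rewrite derivB hornerD hornerN horner_coef0 coef_deriv mulr1n.
  rewrite coef_poly ltnS deriv_exp derivZ derivB derivC derivX.
  rewrite sub0r !hornerE/=.
  rewrite hornerMn hornerM horner_exp !hornerE/=.
  case: n {Q Q0 q Qq} => [|m]; first by rewrite ltnn mulr0n subr0 !mul0r.
  rewrite ltn0Sn bin1 subn1/= ball_ratio0 subr0 -[_ *+ m.+1]mulr_natl.
  ring.
have q0 : q.[0] = n%:R * (4 * (2 * rho) ^+ n.-1).
  by rewrite -Q'0 Qq derivM derivX !hornerE.
rewrite /hypersurface_area; apply: cvg_lim => //.
have -> : n%:R * (2 * (2 * rho) ^+ n.-1) = q.[0] / 2 by rewrite q0; field.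
apply: (@cvg_trans _ ((q.[t] / 2)%:E @[t --> 0^'+])).
  apply: near_eq_cvg; near=> t.
  have t0 : 0 < t by near: t; exact: nbhs_right_gt.
  have tr : t < rho by near: t; exact: nbhs_right_lt.
  rewrite Vol_tube_boundary_cube ?t0// -EFinM; congr EFin.
  have -> : cube_tube_vol R rho n (t ^+ 2) - (2 * (rho - t)) ^+ n = Q.[t].
    by rewrite hornerD hornerN horner_cube_steiner_poly ?ltW// !hornerE.
  rewrite Qq hornerM hornerX invfM; field; by rewrite gt_eqF.
apply: cvg_EFin; first by near=> t.
apply: cvg_at_right_filter; apply: cvgM; last exact: cvg_cst.
exact: continuous_horner.
Unshelve. all: by end_near. Qed.

Lemma shape_factor_cube n : (0 < n)%N -> shape_factor (cube n rho) = n%:R / rho.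
Proof.
case: n => // n _; rewrite /shape_factor hypersurface_area_cube Vol_cube//= exprS.
by field; rewrite expf_neq0 ?mulf_neq0 ?gt_eqF.
Qed.

Lemma renorm_steiner_poly_cube n : (0 < n)%N ->
  renorm_steiner_poly (cube n rho) =
  \sum_(k < n.+1)
    ((n ^_ k)%:R / n%:R ^+ k * (ball_vol R k / (2 ^+ k * k`!%:R))) *: 'X^k.
Proof.
move=> n0; rewrite /renorm_steiner_poly shape_factor_cube// Vol_cube//=.
rewrite steiner_poly_cube// /cube_steiner_poly poly_def raddf_sum/= scaler_sumr.
apply: eq_bigr => k _.
rewrite comp_polyZ comp_Xn_poly (exprZn _ 'X) !scalerA; congr (_ *: _).
have kn : (k <= n)%N by rewrite -ltnS.
rewrite -bin_ffact natrM invf_div expr_div_n.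
have -> : (2 * rho) ^+ n = (2 * rho) ^+ (n - k) * (2 ^+ k * rho ^+ k).
  by rewrite -exprMn -exprD subnK.
have r0 : 2 * rho != 0 by rewrite mulf_neq0 ?gt_eqF.
field.
rewrite !expf_neq0 ?pnatr_eq0 -?lt0n ?fact_gt0// gt_eqF//.
Qed.

Lemma ceval_renorm_cube n (tau : R[i]) : (0 < n)%N ->
  ceval (renorm_steiner_poly (cube n rho)) tau =
  \sum_(k < n.+1)
    ((n ^_ k)%:R / n%:R ^+ k * (ball_vol R k / (2 ^+ k * k`!%:R)))%:C * tau ^+ k.
Proof.
move=> n0; rewrite /ceval renorm_steiner_poly_cube// raddf_sum/= horner_sum.
by apply: eq_bigr => k _; rewrite map_polyZ map_polyXn hornerZ hornerXn.
Qed.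

Lemma cube_limit_termE (tau : R[i]) :
  cube_limit_term tau =
  (fun k => (ball_vol R k / (2 ^+ k * k`!%:R))%:C * tau ^+ k).
Proof.
apply/funext => k; rewrite /cube_limit_term Gamma_fact ball_vol_Gamma expr_div_n.
by congr (_%:C * _); rewrite !invfM; ring.
Qed.

End CubeSteiner.

(* R[i]^o carries the topology of the complex modulus.  The value of the
   sequence at n = 0 is irrelevant to the limit. *)
Theorem mainTheorem5 (R : realType) (rho : R) (hrho : 0 < rho) (tau : R[i]) :
  cvgn (series (cube_limit_term tau : nat -> R[i]^o)) /\
  (fun n : nat => ceval (renorm_steiner_poly (cube n rho)) tau : R[i]^o) @ \oo
    --> limn (series (cube_limit_term tau : nat -> R[i]^o)).
Proof.
rewrite cube_limit_termE.
pose b k : R := ball_vol R k / (2 ^+ k * k`!%:R).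
have hb k : 0 <= b k <= k`!%:R^-1.
  rewrite /b invfM mulrA; apply/andP; split.
    by rewrite !mulr_ge0 ?invr_ge0 ?exprn_ge0 ?ball_vol_ge0.
  rewrite ler_piMl ?invr_ge0// ler_pdivrMr ?exprn_gt0// mul1r.
  exact: ball_vol_le.
have [cs lim] := @binomial_series_limit R b tau hb.
split=> //; rewrite -cvg_shiftS.
rewrite (_ : (fun n => _) = (fun n => \sum_(k < n.+2)
    ((n.+1 ^_ k)%:R / n.+1%:R ^+ k * b k)%:C * tau ^+ k : R[i]^o)).
  by rewrite -cvg_shiftS in lim.
by apply/funext => n; rewrite ceval_renorm_cube.
Qed.
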